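(* Let $X\subset\mathbb T^k$ be a Lebesgue measurable set. Let $G:X\to\mathcal M_n(\mathbb C)^+$ be a bounded measurable field of positive semidefinite matrices with associated measurable eigenvalues $\lambda_j:X\to\mathbb R^+$, $1\le j\le n$, such that $\lambda_1\ge\dots\ge\lambda_n$. Let $1\le d\le n-1$ and let $\beta_j:X\to\mathbb R^+$, $1\le j\le d$, be measurable functions such that $\beta_1\ge\dots\ge\beta_d$. Then the following conditions are equivalent: 1. $\lambda_j(x)\ge\beta_j(x)\ge\lambda_{n-d+j}(x)$ for a.e. $x\in X$ and $1\le j\le d$. 2. There exists a measurable function $P:X\to\mathcal M_n(\mathbb C)^+$ whose values are orthogonal projections such that $\mathrm{rk}\,P(x)=d$ and $\lambda(P(x)\,G(x)\,P(x))=(\beta_1(x),\dots,\beta_d(x),0_{n-d})$ for a.e. $x\in X$.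
   Context: $\mathbb T=[-1/2,1/2)$; $X$ carries the Lebesgue $\sigma$-algebra and measure. $\mathbb R^+=[0,\infty)$. $\mathcal M_n(\mathbb C)^+$ is the set of $n\times n$ positive semidefinite complex matrices. For $S\in\mathcal M_n(\mathbb C)^+$, $\lambda(S)\in\mathbb R^n$ is the vector of eigenvalues of $S$ counting multiplicities in non-increasing order; ''associated measurable eigenvalues'' means $\lambda(G(x))=(\lambda_1(x),\dots,\lambda_n(x))$. $0_{n-d}$ is the zero vector of length $n-d$. *)

(* Defs.v *)
From HB Require Import structures.
From mathcomp Require Import all_boot all_order all_algebra.
From mathcomp Require Import complex.
From mathcomp Require Import all_classical all_reals all_analysis.

Set Implicit Arguments.
Unset Strict Implicit.
Unset Printing Implicit Defensive.

Import Order.TTheory GRing.Theory Num.Theory.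
Import numFieldNormedType.Exports.

Local Open Scope classical_set_scope.
Local Open Scope ring_scope.
Local Open Scope sesquilinear_scope.

Section LebesgueRk.
Context {R : realType} (k : nat).
Implicit Types (A : set 'rV[R]_k) (a b : 'rV[R]_k).

Definition box a b : set 'rV[R]_k := [set x | forall i, a 0 i <= x 0 i < b 0 i].

Definition box_volume a b : R := \prod_(i < k) (b 0 i - a 0 i).

(* At most countable families of boxes: the index set [D] is arbitrary, in
   particular possibly empty, so that the definition is also right for k = 0,
   where every box has volume 1. *)
Definition box_cover A (D : set nat) (a b : nat -> 'rV[R]_k) : Prop :=
  (forall m i, a m 0 i <= b m 0 i) /\ A `<=` \bigcup_(m in D) box (a m) (b m).

Definition lebesgue_outer A : \bar R :=
  ereal_inf [set r | exists (D : set nat) (a b : nat -> 'rV[R]_k),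
    box_cover A D a b /\ r = (\esum_(m in D) (box_volume (a m) (b m))%:E)%E].

End LebesgueRk.

Section LebesgueOuter.
Context {R : realType} (k : nat).
Local Open Scope ereal_scope.
Notation mu := (@lebesgue_outer R k).

Lemma box_volume_ge0 (a b : 'rV[R]_k) :
  (forall i, a 0 i <= b 0 i)%R -> 0 <= (box_volume a b)%:E.
Proof.
by move=> ab; rewrite lee_fin; apply: prodr_ge0 => i _; rewrite subr_ge0.
Qed.

Lemma lebesgue_outer0 : mu set0 = 0.
Proof.
apply/eqP; rewrite eq_le; apply/andP; split.
  apply: ereal_inf_lbound; exists set0, (fun=> 0%R), (fun=> 0%R).
  by rewrite esum_set0; split => //; split => // m i.
by apply: le_ereal_inf_tmp => _ [D [a [b [[ab _] ->]]]];
  apply: esum_ge0 => m _; exact: box_volume_ge0.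
Qed.

Lemma lebesgue_outer_ge0 A : 0 <= mu A.
Proof.
by apply: le_ereal_inf_tmp => _ [D [a [b [[ab _] ->]]]];
  apply: esum_ge0 => m _; exact: box_volume_ge0.
Qed.

Lemma le_lebesgue_outer : {homo mu : A B / A `<=` B >-> A <= B}.
Proof.
move=> A B AB; apply: ereal_inf_le_tmp => _ [D [a [b [[ab Bab] ->]]]].
by exists D, a, b; split => //; split => //; exact: subset_trans AB Bab.
Qed.

Lemma lebesgue_outer_sigma_subadditive : sigma_subadditive mu.
Proof.
move=> A; have [[i ioo]|] := pselect (exists i, mu (A i) = +oo).
  rewrite (eseries_pinfty _ _ ioo) ?leey// => n _.
  by rewrite -ltNye (lt_le_trans _ (lebesgue_outer_ge0 _)).
rewrite -forallNE => Aoo.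
suff add2e (e : {posnum R}) :
    mu (\bigcup_n A n) <= \sum_(i <oo) mu (A i) + e%:num%:E.
  by apply/lee_addgt0Pr => _/posnumP[].
rewrite (le_trans _ (epsilon_trick _ _ _))//; last first.
  by move=> n; exact: lebesgue_outer_ge0.
pose V (c : set nat * (nat -> 'rV[R]_k) * (nat -> 'rV[R]_k)) (m : nat) :=
  (box_volume (c.1.2 m) (c.2 m))%:E.
pose P n c := box_cover (A n) c.1.1 c.1.2 c.2 /\
  \esum_(m in c.1.1) V c m <= mu (A n) + (e%:num / (2 ^ n.+1)%:R)%:E.
have [c Pc] : {c & forall n, P n (c n)}.
  apply: (@choice _ _ P) => n.
  have fA : mu (A n) \is a fin_num.
    by rewrite ge0_fin_numE ?lebesgue_outer_ge0// ltey; apply/eqP/Aoo.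
  have en1 : (0 < e%:num / (2 ^ n.+1)%:R)%R by [].
  have [_ [D [a [b [Dab ->]]]] lt] := lb_ereal_inf_adherent en1 fA.
  by exists (D, a, b); split => //; exact: ltW.
have V0 n m : 0 <= V (c n) m by apply: box_volume_ge0; exact: (Pc n).1.1.
pose K := [set: nat] `*`` (fun n => (c n).1.1).
have -> : \sum_(n <oo) (mu (A n) + (e%:num / (2 ^ n.+1)%:R)%:E) =
    \esum_(n in [set: nat]) (mu (A n) + (e%:num / (2 ^ n.+1)%:R)%:E).
  by apply: nneseries_esumT => n; apply: adde_ge0 => //; exact: lebesgue_outer_ge0.
apply: (@le_trans _ _
    (\esum_(n in [set: nat]) \esum_(m in (c n).1.1) V (c n) m)); last first.
  by apply: le_esum => n _; exact: (Pc n).2.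
rewrite esum_esum//.
pose D := [set p | exists2 q : nat * nat, K q & p = pickle q].
pose u p : nat * nat := odflt (0, 0)%N (unpickle p).
have uK q : u (pickle q) = q by rewrite /u pickleK.
have bij : set_bij D K u.
  split.
  - by move=> _ /= [q Kq ->]; rewrite uK.
  - by move=> x y /set_mem[q _ ->] /set_mem[r _ ->]; rewrite !uK => ->.
  - by move=> q Kq; exists (pickle q); [exists q|exact: uK].
rewrite (reindex_esum _ _ _ _ bij)//.
apply: ereal_inf_lbound.
exists D, (fun p => (c (u p).1).1.2 (u p).2), (fun p => (c (u p).1).2 (u p).2).
split=> //; split; first by move=> p i; exact: (Pc _).1.1.
move=> x [n _ /((Pc n).1.2)[m Dm xm]].
by exists (pickle (n, m)); [exists (n, m)|rewrite /= uK].
Qed.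

End LebesgueOuter.

HB.instance Definition _ (R : realType) (k : nat) :=
  isOuterMeasure.Build R 'rV[R]_k (@lebesgue_outer R k)
    (@lebesgue_outer0 R k) (@lebesgue_outer_ge0 R k)
    (@le_lebesgue_outer R k) (@lebesgue_outer_sigma_subadditive R k).

(* R^k with its (complete) Lebesgue sigma-algebra *)
Definition lebesgueRk (R : realType) (k : nat) :=
  caratheodory_type (@lebesgue_outer R k).
HB.instance Definition _ (R : realType) (k : nat) :=
  Measurable.on (lebesgueRk R k).

Definition lebesgue_measureRk (R : realType) (k : nat) :
  set (lebesgueRk R k) -> \bar R := @lebesgue_outer R k.
HB.instance Definition _ (R : realType) (k : nat) := @isMeasure.Build _
  (lebesgueRk R k) R (@lebesgue_measureRk R k)
  (@caratheodory_measure0 _ _ (@lebesgue_outer R k))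
  (@caratheodory_measure_ge0 _ _ (@lebesgue_outer R k))
  (@caratheodory_measure_sigma_additive _ _ (@lebesgue_outer R k)).
Arguments lebesgue_measureRk : clear implicits.

Lemma lebesgue_measureRk_complete (R : realType) (k : nat) :
  measure_is_complete (lebesgue_measureRk R k).
Proof. exact: measure_is_complete_caratheodory. Qed.

Definition torus (R : realType) (k : nat) : set (lebesgueRk R k) :=
  [set x : 'rV[R]_k | forall i, - 2^-1 <= x 0 i < 2^-1].
Arguments torus : clear implicits.

Section Matrices.
Context {R : realType} {n : nat}.
Implicit Types A P : 'M[R[i]]_n.

(* In the order of R[i], [0 <= z] means that z is real and nonnegative. *)
Definition psdmx A : Prop :=
  A \is hermsymmx /\ forall v : 'cV[R[i]]_n, 0 <= (v^t* *m A *m v) 0 0.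

Definition orthoprojmx P : Prop := P *m P = P /\ P^t* = P.

(* Taking real parts loses nothing on Hermitian matrices, whose characteristic
   polynomial has only real roots. *)
Definition eigvals A : seq R :=
  sort >=%R
    [seq complex.Re z | z <- sval (closed_field_poly_normal (char_poly A))].

Definition measurable_mxfun d (T : measurableType d) (X : set T)
    (F : T -> 'M[R[i]]_n) : Prop :=
  forall i j, measurable_fun X (fun x => complex.Re (F x i j)) /\
              measurable_fun X (fun x => complex.Im (F x i j)).

Lemma size_eigvals A : size (eigvals A) = n.
Proof.
rewrite size_sort size_map; case: closed_field_poly_normal => s /= e.
have := congr1 (size \o polyseq) e; rewrite /= size_char_poly size_scale.
  by rewrite size_prod_XsubC => -[].
by rewrite lead_coef_eq0 monic_neq0// char_poly_monic.
Qed.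

End Matrices.

(* Main.v *)
Require Import Defs.
From mathcomp Require Import all_boot all_order all_algebra.
From mathcomp Require Import fingroup perm.
From mathcomp Require Import complex ring lra zify.
From mathcomp Require Import all_classical all_reals all_analysis.
From mathcomp Require Import measurable_realfun.

(** Necessity is Cauchy interlacing, a dimension count in the style of
    Courant-Fischer.

    Sufficiency has a pointwise and a measurable part. Pointwise, one looks for
    an isometry [V] with [V^t* G V = diag beta], and takes [P = V V^t*]. After
    diagonalising [G], dimensions are removed one at a time through the
    interlacing sequence [max (lambda_(j+1), beta_j)]. For one dimension and
    strict interlacing the columns of [V] are explicit (a Cauchy matrix);
    perturbation and compactness give the general case.

    Measurably, the equations for [V] form a zero set [f x v = 0] in a fixed
    compact cube, with [f] measurable in [x] and continuous in [v]. Maximising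
    the coordinates of [v] successively over this zero set makes the choice
    unique, and each maximum depends measurably on [x]. *)

Set Implicit Arguments.
Unset Strict Implicit.
Unset Printing Implicit Defensive.

Import Order.TTheory GRing.Theory Num.Theory.
Import numFieldNormedType.Exports.

Local Open Scope complex_scope.
Local Open Scope classical_set_scope.
Local Open Scope ring_scope.
Local Open Scope sesquilinear_scope.

(** * Compressing a real diagonal matrix to interlacing diagonal values *)

(* The sum is the coefficient of degree [m] of the Lagrange interpolant of [q]. *)
Lemma sum_horner_div_diff (F : fieldType) m (l : 'I_m.+1 -> F) (q : {poly F}) :
  injective l -> (size q <= m)%N ->
  \sum_i q.[l i] / \prod_(j < m) (l i - l (lift i j)) = 0.
Proof.
move=> l_inj sq.
pose L := \sum_i (q.[l i] / \prod_(j < m) (l i - l (lift i j)))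
   *: \prod_(j < m) ('X - (l (lift i j))%:P).
have horner_prod (i : 'I_m.+1) x : (\prod_(j < m) ('X - (l (lift i j))%:P)).[x] =
    \prod_(j < m) (x - l (lift i j)).
  by rewrite horner_prod; apply: eq_bigr => j _; rewrite hornerXsubC.
have nz (i : 'I_m.+1) : \prod_(j < m) (l i - l (lift i j)) != 0.
  apply/prodf_neq0 => j _; rewrite subr_eq0; apply/eqP => /l_inj /eqP.
  by rewrite (negPf (neq_lift _ _)).
have Lq k : L.[l k] = q.[l k].
  rewrite horner_sum (bigD1 k)//= [X in _ + X]big1 ?addr0.
    by rewrite hornerZ horner_prod divfK.
  move=> i ik; rewrite hornerZ horner_prod.
  case: (unliftP i k) => [j kE|kE]; last by rewrite kE eqxx in ik.
  by rewrite [X in _ * X](bigD1 j)//= -kE subrr mul0r mulr0.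
have szp (i : 'I_m.+1) : size (\prod_(j < m) ('X - (l (lift i j))%:P)) = m.+1.
  by rewrite size_prod_XsubC /index_enum -enumT size_enum_ord.
have szL : (size L <= m.+1)%N.
  apply: (leq_trans (size_sum _ _ _)); apply/bigmax_leqP => i _.
  by apply: (leq_trans (size_scale_leq _ _)); rewrite szp.
(* [L] and [q] agree at [m.+1] distinct points and have degree at most [m], so they coincide; and
   [q] has no term of degree [m]. *)
have LqE : L - q = 0.
  apply: (@roots_geq_poly_eq0 _ _ [seq l i | i <- enum 'I_m.+1]).
  - by apply/allP => _ /mapP[k _ ->]; rewrite /root !hornerE Lq subrr.
  - by rewrite map_inj_uniq ?enum_uniq.
  rewrite size_map size_enum_ord; apply: (leq_trans (size_polyD _ _)).
  by rewrite geq_max szL size_polyN (leq_trans sq).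
move/eqP: LqE; rewrite subr_eq0 => /eqP LqE.
transitivity L`_m; last by rewrite LqE nth_default.
rewrite coef_sum; apply: eq_bigr => i _.
rewrite coefZ.
have := lead_coef_prod_XsubC (index_enum 'I_m) xpredT (fun j => l (lift i j)).
by rewrite lead_coefE szp /= => ->; rewrite mulr1.
Qed.

(** Values are indexed by [nat], not by ordinals, so that dimensions can be removed one at a time
    without casts. *)
Definition compresses (R : nzRingType) (n d : nat) (l b : nat -> R) :=
  exists W : 'M[R]_(n, d), W^T *m W = 1%:M /\
    W^T *m diag_mx (\row_i l i) *m W = diag_mx (\row_j b j).

Lemma compresses_trans (R : comNzRingType) m n p (a b c : nat -> R) :
  compresses m n a b -> compresses n p b c -> compresses m p a c.
Proof.
move=> [V [V1 VD]] [W [W1 WD]]; exists (V *m W); split.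
  by rewrite trmx_mul mulmxA -(mulmxA _ _ V) V1 mulmx1.
by rewrite -WD -VD trmx_mul !mulmxA.
Qed.

Lemma gram_entry (R : nzRingType) n d (W : 'M[R]_(n, d)) i j :
  (W^T *m W) i j = \sum_k W k i * W k j.
Proof. by rewrite mxE; apply: eq_bigr => k _; rewrite mxE. Qed.

Lemma gram_diag_entry (R : comNzRingType) n d (W : 'M[R]_(n, d)) (l : nat -> R) i j :
  (W^T *m diag_mx (\row_i l i) *m W) i j = \sum_(k < n) l k * (W k i * W k j).
Proof.
rewrite mul_mx_diag mxE; apply: eq_bigr => k _; rewrite !mxE.
by rewrite [_ * l k]mulrC mulrA.
Qed.

(* With [w_i = sqrt (prod_j (l_i - g_j) / prod_(k != i) (l_i - l_k))], the
   compression of [diag l] to the hyperplane orthogonal to [w] has eigenvalues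
   [g_j] and eigenvectors [(w_i / (l_i - g_j))_i], by partial fractions. *)
Lemma compresses_strict (R : rcfType) m (l g : nat -> R) :
  (forall j, (j < m)%N -> l j.+1 < g j < l j) -> compresses m.+1 m l g.
Proof.
move=> lg.
have l_decr i j : (i < j <= m)%N -> l j < l i.
  move=> /andP[]; elim: j => // j IH; rewrite ltnS leq_eqVlt => /orP[/eqP->|ij] jm.
    by have /andP[/lt_trans] := lg j jm; apply.
  by have /andP[/lt_trans h /h] := lg j jm; move/lt_trans; apply; apply: IH => //; exact: ltnW.
have gl i j : (i <= j < m)%N -> g j < l i.
  move=> /andP[]; rewrite leq_eqVlt => /orP[/eqP->|ij] jm; have /andP[_ h] := lg j jm => //.
  by apply: (lt_trans h); apply: l_decr; rewrite ij ltnW.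
have lg' i j : (j < i <= m)%N -> l i < g j.
  move=> /andP[]; rewrite leq_eqVlt => /orP[/eqP<-|ij] im.
    by have /andP[] := lg j im.
  have jm : (j < m)%N by apply: leq_trans im; apply: ltnW.
  have /andP[h _] := lg j jm.
  by apply: (lt_trans _ h); apply: l_decr; rewrite ij.
have g_decr i j : (i < j < m)%N -> g j < g i.
  move=> /andP[ij jm]; have /andP[_ h] := lg j jm.
  by apply: (lt_trans h); apply: lg'; rewrite ij ltnW.
have l_inj : injective (fun i : 'I_m.+1 => l i).
  move=> i j /eqP lij; apply/val_inj/eqP; case: (ltngtP i j) lij => // ij.
    by rewrite gt_eqF// l_decr// ij -ltnS ltn_ord.
  by rewrite lt_eqF// l_decr// ij -ltnS ltn_ord.
(* This is the square of the coordinate [w_i]. As [lift i j] is [j.+1] if [i <= j] and [j]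
   otherwise, both terms of each quotient have the same sign. *)
pose w (i : 'I_m.+1) : R := \prod_(j < m) ((l i - g j) / (l i - l (lift i j))).
have w_gt0 i : 0 < w i.
  apply: prodr_gt0 => j _; case: (leqP i j) => ij.
    rewrite divr_gt0// subr_gt0 ?gl ?ij ?ltn_ord//.
    by rewrite l_decr//= /bump ij add1n ltnS ij ltn_ord.
  rewrite -mulrNN -invrN divr_gt0// oppr_gt0 subr_lt0 /= /bump.
    by rewrite lg'// ij -ltnS ltn_ord.
  by rewrite leqNgt ij add0n l_decr// ij -ltnS ltn_ord.
have lgn0 (i : 'I_m.+1) (j : 'I_m) : l i - g j != 0.
  rewrite subr_eq0; case: (leqP i j) => ij.
    by rewrite gt_eqF// gl// ij ltn_ord.
  by rewrite lt_eqF// lg'// ij -ltnS ltn_ord.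
(* Column [j] is orthogonal to the vector of the [sqrt (w i)]: cancelling [l i - g j] leaves an
   interpolation sum for [q], of degree [m - 1]. *)
have sum1 (j : 'I_m) : \sum_i w i / (l i - g j) = 0.
  pose q := \prod_(k < m | k != j) ('X - (g k)%:P).
  have sq : (size q <= m)%N.
    have : size (\prod_(k < m) ('X - (g k)%:P)) = m.+1.
      by rewrite size_prod_XsubC /index_enum -enumT size_enum_ord.
    rewrite (bigD1 j)//= -/q.
    have q0 : q != 0 by rewrite monic_neq0// monic_prod_XsubC.
    by rewrite size_mul ?polyXsubC_eq0// size_XsubC addSn add1n => -[->].
  rewrite -[RHS](sum_horner_div_diff l_inj sq); apply: eq_bigr => i _.
  rewrite /w prodf_div (bigD1 j)//= horner_prod.
  under [in RHS]eq_bigr do rewrite hornerXsubC.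
  by rewrite [LHS]mulrAC [X in X / _ / _]mulrC mulfK.
have sum2 (j k : 'I_m) : j != k ->
    \sum_i w i / (l i - g j) / (l i - g k) = 0.
  move=> jk; have gjk : g j - g k != 0.
    rewrite subr_eq0; case: (ltngtP j k) => jk'.
    - by rewrite gt_eqF// g_decr// jk' ltn_ord.
    - by rewrite lt_eqF// g_decr// jk' ltn_ord.
    - by rewrite (val_inj jk') eqxx in jk.
  transitivity ((\sum_i w i / (l i - g j) - \sum_i w i / (l i - g k)) / (g j - g k)).
    rewrite -sumrB mulr_suml; apply: eq_bigr => i _.
    by field; rewrite gjk !lgn0.
  by rewrite !sum1 subrr mul0r.
pose N (j : 'I_m) := \sum_i w i / (l i - g j) / (l i - g j).
have N_gt0 j : 0 < N j.
  have h i : 0 < w i / (l i - g j) / (l i - g j).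
    rewrite -mulrA mulr_gt0// -expr2 exprn_even_gt0//= invr_neq0//.
  rewrite /N (bigD1 ord0)//= ltr_pwDl//; apply: sumr_ge0 => i _; exact: ltW.
pose W : 'M[R]_(m.+1, m) := \matrix_(i, j) (Num.sqrt (w i) / (l i - g j) / Num.sqrt (N j)).
have sqrtN j : Num.sqrt (N j) != 0 by rewrite gt_eqF// sqrtr_gt0.
have WW i j k : W i j * W i k = w i / (l i - g j) / (l i - g k) / (Num.sqrt (N j) * Num.sqrt (N k)).
  have sw : w i = Num.sqrt (w i) * Num.sqrt (w i) by rewrite -expr2 sqr_sqrtr// ltW.
  rewrite [in RHS]sw !mxE.
  by field; rewrite !lgn0 !sqrtN.
have G j k : \sum_i W i j * W i k = (j == k)%:R.
  under eq_bigr do rewrite WW.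
  rewrite -mulr_suml; have [->|jk] := eqVneq j k; last by rewrite sum2// mul0r.
  by rewrite -/(N k) -expr2 sqr_sqrtr ?divff// ?gt_eqF// ltW.
exists W; split; apply/matrixP => j k; first by rewrite gram_entry G !mxE.
rewrite gram_diag_entry !mxE.
(* Writing [l i = g k + (l i - g k)] separates a multiple of the Gram entry from a remainder that
   [sum1] annihilates. *)
transitivity (g k * (\sum_i W i j * W i k) +
  (\sum_i w i / (l i - g j)) / (Num.sqrt (N j) * Num.sqrt (N k))).
  rewrite mulr_sumr mulr_suml -big_split/=; apply: eq_bigr => i _; rewrite WW.
  by field; rewrite !lgn0 !sqrtN.
rewrite sum1 mul0r addr0 G; case: eqVneq => [->|]; first by rewrite mulr1n mulr1.
by rewrite mulr0 mulr0n.
Qed.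

(** * Measurable selection of zeros *)

(** [|f|] attains its minimum on [K], which cannot be positive. This serves both to pass to the
    limit in perturbations and to detect zeros on a dense sequence. *)
Lemma compact_zero (R : realType) (Y : topologicalType) (K : set Y) (f : Y -> R) :
  compact K -> continuous f ->
  (forall e : R, 0 < e -> exists2 v, K v & `|f v| < e) -> exists2 v, K v & f v = 0.
Proof.
move=> cK cf f0.
have K0 : K !=set0 by have [v Kv _] := f0 1 ltr01; exists v.
have cnf : {within K, continuous (fun v => `|f v|)}.
  by apply: continuous_subspaceT => v; apply: cvg_norm; exact: cf.
have [c Kc cmin] := compact_EVT_min K0 cK cnf.
exists c; first exact: set_mem.
apply/normr0_eq0/eqP; rewrite eq_le normr_ge0 andbT leNgt; apply/negP => fc.
have [v Kv] := f0 _ fc.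
by rewrite ltNge cmin// mem_set.
Qed.

Section Selection.
Context d (T : measurableType d) (R : realType) (X : set T) (mX : measurable X).
Context (Y : topologicalType) (K : set Y) (cK : compact K).
Context (q : nat -> Y) (qK : forall m, K (q m)) (Kq : K `<=` closure (range q)).

(** Known as Caratheodory functions: measurable in the parameter, continuous in the variable. *)
Definition caratheodory (f : T -> Y -> R) :=
  (forall v, measurable_fun X (f^~ v)) /\ (forall x, X x -> continuous (f x)).

(** By density and continuity, a zero makes [|f x (q k)|] arbitrarily small for suitable [k];
    compactness gives the converse. This leaves countable unions and intersections. *)
Lemma measurable_ex_zero (f : T -> Y -> R) : caratheodory f ->
  measurable (X `&` [set x | exists2 v, K v & f x v = 0]).
Proof.
move=> [mf cf].
rewrite (_ : _ `&` _ =
  \bigcap_(m in [set: nat]) \bigcup_(k in [set: nat])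
     (X `&` [set x | `|f x (q k)| < m.+1%:R^-1])).
  apply: bigcapT_measurable => m; apply: bigcupT_measurable => k.
  have mfk : measurable_fun X (fun x => `|f x (q k)| < m.+1%:R^-1).
    by apply: measurable_fun_ltr => //; exact: measurableT_comp.
  by have := mfk mX [set true] I; rewrite preimage_true.
apply/seteqP; split => [x [Xx [v Kv fv]] m _|x xfq].
  have : nbhs v [set u | `|f x u| < m.+1%:R^-1].
    have /(_ v) := cf x Xx; move/cvgr_dist_lt => /(_ m.+1%:R^-1).
    rewrite invr_gt0 ltr0n => /(_ isT); rewrite fv.
    by apply: filterS => u; rewrite sub0r normrN.
  by move=> /(Kq Kv)[_ [[k _ <-] /= fk]]; exists k.
have Xx : X x by have [k _ []] := xfq 0%N I.
split => //; apply: (compact_zero cK (cf x Xx)) => e e0.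
have [m em] : exists m, m.+1%:R^-1 < e.
  exists (Num.bound e^-1); rewrite invf_plt ?posrE// ?ltr0n//.
  apply: lt_trans (archi_boundP _) _; first by rewrite invr_ge0 ltW.
  by rewrite ltr_nat.
have [k _ [_ /= fk]] := xfq m I.
by exists (q k) => //; exact: lt_trans em.
Qed.

(** A maximiser of [h] over the zeros need not be unique, but the maximum is; hence [p] is
    measurable although [s] is chosen arbitrarily. *)
Lemma select_coordinate (f : T -> Y -> R) (h : Y -> R) :
  caratheodory f -> continuous h ->
  (forall x, X x -> exists2 v, K v & f x v = 0) ->
  exists2 p : T -> R, measurable_fun X p &
    forall x, X x -> exists2 v, K v & f x v = 0 /\ h v = p x.
Proof.
move=> /[dup] cf [mf cof] ch f0.
have [s sP] : exists s : T -> Y, forall x, X x -> [/\ K (s x), f x (s x) = 0 &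
    forall v, K v -> f x v = 0 -> h v <= h (s x)].
  suff : forall x, exists v, X x -> [/\ K v, f x v = 0 &
      forall u, K u -> f x u = 0 -> h u <= h v] by move=> /choice[s sP]; exists s.
  move=> x; have [Xx|nXx] := pselect (X x); last by exists (q 0).
  have cZ : compact (K `&` f x @^-1` [set 0]).
    apply: compact_closedI => //; apply: preimage_closed; last exact: closed_eq.
    by move=> v _; exact: cof.
  have Z0 : K `&` f x @^-1` [set 0] !=set0 by have [v ? ?] := f0 x Xx; exists v.
  have [v /set_mem[Kv fv] vmax] := compact_EVT_max Z0 cZ (continuous_subspaceT ch).
  by exists v => _; split => // u Ku fu; apply: vmax; rewrite inE.
(* [c <= p x] iff some zero [v] of [f x] in [K] has [c <= h v]. *)
exists (h \o s); last by move=> x /sP[? ? _]; exists (s x).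
apply: (measurability _ (RGenCInfty.measurableE R)) => _ [_ [c ->] <-].
rewrite preimage_itvcy.
rewrite (_ : _ `&` _ = X `&` [set x | exists2 v, K v &
    `|f x v| + Num.max 0 (c - h v) = 0]).
  apply: measurable_ex_zero; split => [v|x Xx v].
    by apply: measurable_funD => //; exact: measurableT_comp.
  apply: cvgD; first by apply: cvg_norm; exact: cof.
  apply: (@continuous_max _ _ (cst 0) (fun v => c - h v)); first exact: cvg_cst.
  by apply: cvgB; [exact: cvg_cst|exact: ch].
apply/seteqP; split => x [Xx] /=; have [Ks fs smax] := sP x Xx.
  move=> ch'; split => //; exists (s x) => //.
  by rewrite fs normr0 add0r; apply/max_idPl; rewrite subr_le0.
move=> [v Kv /eqP]; rewrite paddr_eq0 ?le_max ?lexx// normr_eq0 => /andP[/eqP fv /eqP].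
move/max_idPl; rewrite subr_le0 => cv; split => //.
by apply: le_trans cv _; exact: smax.
Qed.

(* Each step adds [`|h i v - p i x|] to [f], freezing the coordinates already chosen. *)
Lemma select_coordinates (I : eqType) (r : seq I) (f : T -> Y -> R) (h : I -> Y -> R) :
  caratheodory f -> (forall i, continuous (h i)) ->
  (forall x, X x -> exists2 v, K v & f x v = 0) ->
  exists2 p : I -> T -> R, (forall i, i \in r -> measurable_fun X (p i)) &
    forall x, X x -> exists2 v, K v & f x v = 0 /\ forall i, i \in r -> h i v = p i x.
Proof.
move=> cf ch; elim: r f cf => [|i r IH] f cf f0.
  by exists (fun _ _ => 0) => // x /f0[v Kv fv]; exists v.
have [p mp pP] := select_coordinate cf (ch i) f0.
have cf' : caratheodory (fun x v => `|f x v| + `|h i v - p x|).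
  case: cf => mf cof; split => [v|x Xx v].
    apply: measurable_funD; first exact: measurableT_comp.
    by apply: measurableT_comp => //; exact: measurable_funB.
  apply: cvgD; apply: cvg_norm; first exact: cof.
  by apply: cvgB; [exact: ch|exact: cvg_cst].
have [|p' mp' p'P] := IH _ cf'.
  by move=> x /pP[v Kv [fv hv]]; exists v => //; rewrite fv hv subrr normr0 addr0.
exists (fun j => if j == i then p else p' j).
  by move=> j; rewrite in_cons; case: eqP => //= _; exact: mp'.
move=> x /p'P[v Kv [/eqP]].
rewrite paddr_eq0// !normr_eq0 subr_eq0 => /andP[/eqP fv /eqP hv] hp'.
exists v => //; split => // j; rewrite in_cons; case: eqP => [->//|_] /=.
exact: hp'.
Qed.

End Selection.

(** * The cube of coordinates, and algebras of continuous or measurable functions *)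

Section Cube.
Context (R : realType) (N : nat).

Definition cube : set 'rV[R]_N := [set v | forall i, `|v 0 i| <= 1].

Lemma compact_cube : compact cube.
Proof.
have /= := @rV_compact R N (fun=> [set` `[-1, 1]]) (fun=> @segment_compact R (-1) 1).
congr compact; apply/seteqP; split => v /= + i => /(_ i); rewrite ler_norml in_itv/=; case/andP => h1 h2; apply/andP; split; [exact: h1|exact: h2|exact: h1|exact: h2].
Qed.

Lemma dense_cube : exists2 q : nat -> 'rV[R]_N,
  (forall m, cube (q m)) & cube `<=` closure (range q).
Proof.
(* Clipping puts rationals into [[-1, 1]] and never moves them away from a point of it. *)
pose clip (r : rat) : R := Num.max (-1) (Num.min 1 (ratr r)).
pose q m : 'rV[R]_N :=
  \row_i clip ((odflt [ffun=> 0] (unpickle m) : {ffun 'I_N -> rat}) i).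
exists q => [m i|v Kv B /nbhs_ballP[e /= e0 eB]].
  rewrite mxE ler_norml /clip le_max lexx/= ge_max ge_min lexx/= andbT; lra.
have /choice[f fP] : forall i, exists r, `|v 0 i - clip r| < e.
  move=> i.
  have /rat_in_itvoo[r] : v 0 i - e < v 0 i + e by rewrite ltrBlDr -addrA ltrDl addr_gt0.
  rewrite in_itv/= => /andP[r1 r2]; exists r.
  have := Kv i; rewrite ler_norml /clip => /andP[v1 v2].
  rewrite ltr_norml; by case: (leP 1 (ratr r)) => ?; [case: (leP (-1) 1) => ?|case: (leP (-1) (ratr r)) => ?];
    apply/andP; split; lra.
exists (q (pickle [ffun i => f i])); split; first by exists (pickle [ffun i => f i]).
apply: eB; split => // i j; rewrite ord1 /q pickleK/= mxE ffunE; exact: fP.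
Qed.

End Cube.

(** The error terms below arise from coordinates by sums, products and absolute values, so one
    argument over [C] covers both continuity and measurability. *)
Definition function_algebra (R : realType) (S : Type) (C : set (S -> R)) : Prop :=
  [/\ forall c, C (cst c),
      forall f g, C f -> C g -> C (f \+ g),
      forall f g, C f -> C g -> C (f \* g) &
      forall f, C f -> C (fun x => `|f x|)].

Lemma function_algebra_sum (R : realType) S (C : set (S -> R)) (I : Type) (r : seq I)
    (P : pred I) (F : I -> S -> R) :
  function_algebra C -> (forall i, C (F i)) -> C (fun x => \sum_(i <- r | P i) F i x).
Proof.
move=> [Cc CD _ _] CF; elim: r => [|i r IH].
  by have := Cc 0; congr C; apply/funext => x; rewrite big_nil.
have [Pi|nPi] := boolP (P i).
  by have := CD _ _ (CF i) IH; congr C; apply/funext => x; rewrite big_cons Pi.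
by move: IH; congr C; apply/funext => x; rewrite big_cons (negPf nPi).
Qed.

Lemma function_algebra_continuous (R : realType) (Y : topologicalType) :
  function_algebra [set f : Y -> R | continuous f].
Proof.
split=> /=.
- by move=> c x; exact: cvg_cst.
- by move=> f g cf cg x; apply: cvgD; [exact: cf|exact: cg].
- by move=> f g cf cg x; apply: cvgM; [exact: cf|exact: cg].
- by move=> f cf x; apply: cvg_norm; exact: cf.
Qed.

Lemma function_algebra_measurable d (T : measurableType d) (R : realType) (X : set T) :
  function_algebra [set f : T -> R | measurable_fun X f].
Proof.
split=> /=.
- by move=> c; exact: measurable_cst.
- by move=> f g; exact: measurable_funD.
- by move=> f g; exact: measurable_funM.
- by move=> f mf; exact: measurableT_comp.
Qed.

(** * From strict to weak interlacing *)

(** The columns of [W] are unit vectors. This keeps the solutions of the perturbed problems in the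
    cube. *)
Lemma gram_entry_le1 (R : realDomainType) n d (W : 'M[R]_(n, d)) i j :
  W^T *m W = 1%:M -> `|W i j| <= 1.
Proof.
move=> /matrixP/(_ j j); rewrite gram_entry mxE eqxx => W1.
rewrite -[leRHS]normr1 -ler_sqr ?nnegrE// real_normK ?num_real// normr1 expr1n -[leRHS]W1.
rewrite (bigD1 i)//= expr2 lerDl; apply: sumr_ge0 => k _; exact: sqr_ge0.
Qed.

(** The total error [f] vanishes exactly at the solutions. Solutions for nearby strictly interlacing
    data make it arbitrarily small in the cube, so compactness gives a zero. *)
Lemma compresses_step (R : realType) m (l g : nat -> R) :
  (forall j, (j < m)%N -> l j.+1 <= g j <= l j) -> compresses m.+1 m l g.
Proof.
move=> lg.
pose E (W : 'M[R]_(m.+1, m)) i j :=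
  `|\sum_k W k i * W k j + - (i == j)%:R| +
  `|\sum_(k < m.+1) l k * (W k i * W k j) + - (g j *+ (i == j))|.
pose f (v : 'rV[R]_(m.+1 * m)) := \sum_i \sum_j E (vec_mx v) i j.
have Cf (C : set ('rV[R]_(m.+1 * m) -> R)) : function_algebra C ->
    (forall i j, C (fun v => vec_mx v i j)) -> C f.
  move=> FA Cw; have [Cc CD CM CN] := FA.
  do 2!apply: (function_algebra_sum _ _ FA) => ?.
  apply: (CD); apply: (CN); (apply: (CD); last exact: Cc);
    apply: (function_algebra_sum _ _ FA) => k.
    by apply: (CM); exact: Cw.
  by apply: (CM); [exact: Cc|apply: (CM); exact: Cw].
have cf : continuous f.
  apply: (Cf _ (@function_algebra_continuous R 'rV[R]_(m.+1 * m))) => i j /=.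
  by under eq_fun do rewrite mxE; exact: coord_continuous.
suff [v _ fv] : exists2 v, cube v & f v = 0.
  have E0 W i j : 0 <= E W i j by rewrite addr_ge0.
  have Ev i j : E (vec_mx v) i j = 0.
    move: fv; rewrite /f => /eqP; rewrite psumr_eq0; last by move=> *; exact: sumr_ge0.
    move=> /allP/(_ i (mem_index_enum _))/= /eqP/eqP; rewrite psumr_eq0//.
    by move=> /allP/(_ j (mem_index_enum _))/= /eqP.
  exists (vec_mx v); split; apply/matrixP => i j.
    rewrite gram_entry !mxE; apply/eqP; rewrite -subr_eq0 -normr_eq0.
    have /eqP := Ev i j; rewrite paddr_eq0// => /andP[+ _].
    by apply: etrans; congr (`|_| == _); congr (_ + _).
  rewrite gram_diag_entry !mxE; apply/eqP; rewrite -subr_eq0 -normr_eq0.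
  have /eqP := Ev i j; rewrite paddr_eq0// => /andP[_].
  apply: etrans; congr (`|_| == _); congr (_ - _).
  by case: eqVneq => [->|].
apply: (compact_zero (@compact_cube _ _) cf) => e e0.
(* [M * h] will bound [f] at the perturbed solution: entries of [W] are at most 1 in absolute value,
   and the shifts below are [k.*2 * h] for [l k] and [j.*2.+1 * h] for [g j]. *)
pose M : R := \sum_(i < m) \sum_(j < m) (\sum_(k < m.+1) k.*2%:R + j.*2.+1%:R).
have M0 : 0 <= M by apply: sumr_ge0 => *; apply: sumr_ge0 => *; apply: addr_ge0 => //; exact: sumr_ge0.
have [h h0 Mh] : exists2 h, 0 < h & M * h < e.
  have M1 : 0 < M + 1 by lra.
  exists (e / (M + 1)); first by rewrite divr_gt0.
  by rewrite mulrCA -[ltRHS]mulr1 ltr_pM2l// ltr_pdivrMr// mul1r ltrDl.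
have h_ge0 := ltW h0.
(* Lowering [l_0 > g_0 > l_1 > ...] by [0, h, 2h, ...] makes the interlacing strict. *)
pose l' i := l i - i.*2%:R * h.
pose g' j := g j - j.*2.+1%:R * h.
have [|W [W1 WD]] := @compresses_strict R m l' g'.
  move=> j jm; have /andP[lg1 lg2] := lg j jm; apply/andP; split;
    by apply: ler_ltD => //; rewrite ltrN2 ltr_pM2r// ltr_nat ?doubleS.
have Wle i j := gram_entry_le1 i j W1.
exists (mxvec W); first by move=> i; case/mxvec_indexP: i => i j; rewrite mxvecE.
rewrite /f mxvecK ger0_norm; last by apply: sumr_ge0 => *; apply: sumr_ge0 => *; rewrite addr_ge0.
apply: le_lt_trans Mh.
rewrite mulr_suml ler_sum// => i _; rewrite mulr_suml ler_sum// => j _.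
rewrite /E -gram_entry W1 mxE subrr normr0 add0r.
have := congr1 (fun A : 'M[R]_m => A i j) WD.
rewrite gram_diag_entry !mxE => WDij.
have -> : \sum_(k < m.+1) l k * (W k i * W k j) =
    g' j *+ (i == j) + \sum_(k < m.+1) k.*2%:R * h * (W k i * W k j).
  have -> : g' j *+ (i == j) = g' i *+ (i == j) by case: eqP => [->|].
  rewrite -WDij.
  by rewrite -big_split/=; apply: eq_bigr => k _; rewrite /l'; ring.
rewrite addrAC -mulrnBl addrC mulrDl.
apply: le_trans (ler_normD _ _) _; apply: lerD.
  rewrite mulr_suml; apply: le_trans (ler_norm_sum _ _ _) _; apply: ler_sum => k _.
  rewrite normrM ger0_norm ?mulr_ge0//; apply: ler_piMr; first by rewrite mulr_ge0.
  by rewrite normrM mulr_ile1.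
rewrite /g' addrAC subrr add0r mulNrn normrN normrMn.
rewrite ger0_norm ?mulr_ge0//.
by case: eqP => // _; rewrite mulr0n mulr_ge0.
Qed.

(** Induction on the codimension [c]. The intermediate [g] is the least sequence that one step from
    [l] allows and that dominates [b]; being least, it still satisfies the lower bounds. *)
Lemma compresses_interlaces (R : realType) c d (l b : nat -> R) :
  (forall i, (i.+1 < c + d)%N -> l i.+1 <= l i) ->
  (forall j, (j.+1 < d)%N -> b j.+1 <= b j) ->
  (forall j, (j < d)%N -> l (c + j)%N <= b j <= l j) ->
  compresses (c + d) d l b.
Proof.
elim: c l => [|c IH] l ll bb lb.
  exists 1%:M; rewrite trmx1 !mul1mx !mulmx1; split => //.
  by congr diag_mx; apply/rowP => j; rewrite !mxE; apply/le_anti; have := lb j (ltn_ord j); rewrite add0n andbC.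
pose g j := if (j < d)%N then Num.max (l j.+1) (b j) else l j.+1.
apply: (@compresses_trans _ (c + d).+1 (c + d) d _ g).
  apply: compresses_step => j jcd; rewrite /g; case: ifPn => jd.
    by have /andP[_ ?] := lb j jd; rewrite le_max lexx ge_max ll.
  by rewrite lexx ll.
apply: IH => //.
  move=> i icd; rewrite /g; case: (ltnP i d) => id.
    case: (ltnP i.+1 d) => id'.
      by rewrite ge_max !le_max ll// bb// orbT.
    by rewrite le_max ll.
  by rewrite ltnNge (leq_trans id)//= ll.
move=> j jd; rewrite /g jd le_max lexx orbT andbT.
have /andP[lb1 _] := lb j jd.
case: ifPn => // cjd; rewrite ge_max lb1/=.
have : forall i, (j + i < d)%N -> b (j + i)%N <= b j.
  elim=> [|i IHi] h; first by rewrite addn0.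
  rewrite addnS; rewrite addnS in h.
  by apply: le_trans (bb _ h) (IHi _); exact: ltnW.
by rewrite addnC; apply; rewrite addnC.
Qed.

(** * Spectra of Hermitian matrices and of their compressions *)

Lemma trmxC_mul (C : numClosedFieldType) m n p (A : 'M[C]_(m, n)) (B : 'M[C]_(n, p)) :
  (A *m B)^t* = B^t* *m A^t*.
Proof. by rewrite trmx_mul map_mxM. Qed.

Lemma hermsymmx_eq (C : numClosedFieldType) n (A : 'M[C]_n) :
  (A \is hermsymmx) = (A^t* == A).
Proof. by rewrite is_hermitianmxE expr0 scale1r eq_sym. Qed.

(** A form of Sylvester's determinant identity: both products have the same spectrum up to zeros. It
    serves for unitary conjugation and for the spectrum of [P *m A *m P]. *)
Lemma char_poly_mulmxC (F : fieldType) n d (V : 'M[F]_(n, d)) (B : 'M[F]_(d, n)) :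
  char_poly (V *m B) * 'X^d = 'X^n * char_poly (B *m V).
Proof.
pose W := map_mx polyC V; pose D := map_mx polyC B.
(* Both sides are computed from [\det M] by eliminating one of its off-diagonal blocks. *)
pose M := block_mx ('X%:M : 'M[_]_n) W D (1%:M : 'M[_]_d).
have E1 : M *m block_mx 1%:M 0 (- D) 1%:M =
    block_mx (char_poly_mx (V *m B)) W 0 1%:M.
  rewrite mulmx_block !mulmx1 !mulmx0 !mul1mx !add0r addrN.
  by rewrite mulmxN /char_poly_mx map_mxM.
have E2 : M *m block_mx 1%:M (- W) 0 'X%:M =
    block_mx 'X%:M 0 D (char_poly_mx (B *m V)).
  rewrite mulmx_block !mulmx1 !mulmx0 !mul1mx !addr0 !mulmxN.
  by rewrite mul_mx_scalar mul_scalar_mx addNr /char_poly_mx map_mxM addrC.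
have := congr1 determinant E1; have := congr1 determinant E2.
rewrite !det_mulmx !det_lblock !det_ublock !det1 !mulr1 !mul1r !det_scalar.
by move=> e2 e1; rewrite /char_poly -e1 e2.
Qed.

Lemma char_poly_diag (R : comNzRingType) n (u : 'rV[R]_n) :
  char_poly (diag_mx u) = \prod_i ('X - (u 0 i)%:P).
Proof.
rewrite char_poly_trig ?diag_mx_is_trig//.
by apply: eq_bigr => i _; rewrite mxE eqxx.
Qed.

Section Spectral.
Context {R : realType}.
Local Notation C := R[i].

(** [eigvals] relies on a chosen list of roots; unique factorisation determines it up to
    permutation, and sorting removes the ambiguity. *)
Lemma eigvals_char_poly n (A : 'M[C]_n) (s : seq C) :
  char_poly A = \prod_(z <- s) ('X - z%:P) ->
  eigvals A = sort >=%R [seq complex.Re z | z <- s].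
Proof.
move=> As; rewrite /eigvals; case: closed_field_poly_normal => r /= rE.
apply/perm_sortP; first exact: ge_total.
- exact: ge_trans.
- exact: ge_anti.
apply/perm_map/prod_XsubC_eq; rewrite -As [RHS]rE.
by rewrite (monicP (char_poly_monic A)) scale1r.
Qed.

Lemma eigvals_sorted_char_poly n (A : 'M[C]_n) (t : seq R) :
  sorted >=%R t -> char_poly A = \prod_(x <- t) ('X - x%:C%:P) -> eigvals A = t.
Proof.
move=> st At; rewrite (@eigvals_char_poly _ _ [seq x%:C | x <- t]) ?big_map//.
by rewrite -map_comp map_id_in// sorted_sort//; exact: ge_trans.
Qed.

(** The spectral theorem gives the eigenvalues in no particular order, so the rows of the unitary
    matrix are permuted to match the sorted list. *)
Lemma spectral_eigvals n (A : 'M[C]_n) : A \is hermsymmx ->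
  exists2 U : 'M[C]_n, U \is unitarymx &
    A = U^t* *m diag_mx (\row_i (nth 0 (eigvals A) i)%:C) *m U.
Proof.
move=> hA; pose S := spectralmx A; pose D := spectral_diag A.
have uS : S \is unitarymx := spectral_unitarymx A.
have AE : A = S^t* *m diag_mx D *m S.
  have /hermitian_normalmx/orthomx_spectralP := hA.
  by rewrite invmx_unitary.
have Dreal i : (complex.Re (D 0 i))%:C = D 0 i.
  by apply: RRe_real; have /mxOverP := hermitian_spectral_diag_real hA; apply.
have cA : char_poly A = \prod_(z <- [seq D 0 i | i <- enum 'I_n]) ('X - z%:P).
  have Xn0 : 'X^n != 0 :> {poly C} by rewrite monic_neq0 ?monicXn.
  apply: (mulfI Xn0); rewrite big_map big_enum -char_poly_diag mulrC.
  rewrite AE -mulmxA char_poly_mulmxC -mulmxA.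
  by rewrite (unitarymxP uS) mulmx1.
have [p pE] : exists p : 'S_n, forall i : 'I_n,
    (nth 0 (eigvals A) i)%:C = D 0 (p i).
  have : perm_eq (eigvals A) [tuple complex.Re (D 0 i) | i < n].
    rewrite (eigvals_char_poly cA) -map_comp /= perm_sort.
    by apply/seq.permP => P; congr count; apply: eq_map.
  move/tuple_permP => [p pE]; exists p => i.
  by rewrite pE -tnth_nth !tnth_mktuple Dreal.
exists (row_perm p S).
  apply/unitarymxP/matrixP => i j; rewrite !mxE.
  have /unitarymxP/matrixP/(_ (p i) (p j)) := uS; rewrite !mxE (inj_eq perm_inj) => <-.
  by apply: eq_bigr => k _; rewrite !mxE.
rewrite {1}AE; apply/matrixP => i j; rewrite !mul_mx_diag !mxE.
rewrite (reindex_inj (@perm_inj _ p))/=; apply: eq_bigr => k _.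
by rewrite !mxE pE.
Qed.

Lemma conjC_realc (x : R) : (x%:C)^* = x%:C.
Proof. by apply/CrealP/complex_realP; exists x. Qed.

Lemma diag_form n (U : 'M[C]_n) (a : 'I_n -> R) (v : 'cV[C]_n) :
  (v^t* *m (U^t* *m diag_mx (\row_i (a i)%:C) *m U) *m v) 0 0 =
  \sum_i (a i)%:C * ((U *m v) i 0 * ((U *m v) i 0)^*).
Proof.
rewrite -!mulmxA mulmxA -trmxC_mul mulmxA mul_mx_diag mxE.
move: (U *m v) => w; apply: eq_bigr => i _; rewrite !mxE.
by rewrite [_ * (a i)%:C]mulrC -mulrA [_ * w i 0]mulrC.
Qed.

Lemma unitary_form n (U : 'M[C]_n) (v : 'cV[C]_n) : U \is unitarymx ->
  (v^t* *m v) 0 0 = \sum_i ((U *m v) i 0 * ((U *m v) i 0)^*).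
Proof.
move=> uU; have := diag_form U (fun=> 1) v; under [X in _ = X -> _]eq_bigr do rewrite mul1r.
move=> <-; rewrite (_ : diag_mx _ = 1%:M) ?mulmx1; last first.
  by apply/matrixP => i j; rewrite !mxE.
have : U^t* \is unitarymx by rewrite trmxC_unitary.
by move/unitarymxP; rewrite trmxCK => ->; rewrite mulmx1.
Qed.

Lemma form_ge0 n (v : 'cV[C]_n) : 0 <= (v^t* *m v) 0 0.
Proof. by rewrite mxE; apply: sumr_ge0 => i _; rewrite !mxE mulrC mul_conjC_ge0. Qed.

Lemma form_gt0 n (v : 'cV[C]_n) : v != 0 -> 0 < (v^t* *m v) 0 0.
Proof.
move=> v0; rewrite lt_def form_ge0 andbT; apply: contra v0.
rewrite mxE psumr_eq0; last by move=> i _; rewrite !mxE mulrC mul_conjC_ge0.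
move=> /allP v0; apply/eqP/colP => i; have := v0 i (mem_index_enum _).
by rewrite !mxE mulrC mul_conjC_eq0 => /eqP.
Qed.

(** In the coordinates [U *m v] the form is the sum of the [a i] times squared moduli, so only
    indices with a nonzero coordinate contribute. *)
Lemma diag_form_le n (U : 'M[C]_n) (a : 'I_n -> R) (c : R) (v : 'cV[C]_n) :
  U \is unitarymx -> (forall i, (U *m v) i 0 != 0 -> a i <= c) ->
  (v^t* *m (U^t* *m diag_mx (\row_i (a i)%:C) *m U) *m v) 0 0 <= c%:C * (v^t* *m v) 0 0.
Proof.
move=> uU ac; rewrite diag_form (unitary_form v uU) mulr_sumr; apply: ler_sum => i _.
have [->|/ac aci] := eqVneq ((U *m v) i 0) 0; first by rewrite mul0r !mulr0.
by rewrite ler_wpM2r ?mul_conjC_ge0 ?lecR.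
Qed.

Lemma diag_form_ge n (U : 'M[C]_n) (a : 'I_n -> R) (c : R) (v : 'cV[C]_n) :
  U \is unitarymx -> (forall i, (U *m v) i 0 != 0 -> c <= a i) ->
  c%:C * (v^t* *m v) 0 0 <= (v^t* *m (U^t* *m diag_mx (\row_i (a i)%:C) *m U) *m v) 0 0.
Proof.
move=> uU ac; rewrite diag_form (unitary_form v uU) mulr_sumr; apply: ler_sum => i _.
have [->|/ac aci] := eqVneq ((U *m v) i 0) 0; first by rewrite mul0r !mulr0.
by rewrite ler_wpM2r ?mul_conjC_ge0 ?lecR.
Qed.

(** Each matrix describes a subspace as its kernel. The rank of the stacked matrix is at most the
    sum of the ranks, so the three subspaces meet nontrivially. *)
Lemma exists_ker n (M N L : 'M[C]_n) : (\rank M + \rank N + \rank L < n)%N ->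
  exists2 v : 'cV[C]_n, v != 0 & [/\ M *m v = 0, N *m v = 0 & L *m v = 0].
Proof.
move=> rk; pose W := col_mx (col_mx M N) L.
have rW : (\rank W < n)%N.
  apply: leq_ltn_trans rk; rewrite -addsmxE.
  apply: leq_trans (mxrank_adds_leqif _ _) _; rewrite leq_add2r -addsmxE.
  exact: mxrank_adds_leqif.
have [j cj] : exists j, col j (cokermx W) != 0.
  apply/existsP; rewrite -negb_forall; apply: contraTN rW => /forallP cW.
  have : cokermx W = 0 by apply/matrixP => i j; have /eqP/colP/(_ i) := cW j; rewrite !mxE.
  by move/(congr1 mxrank)/eqP; rewrite mxrank_coker mxrank0 subn_eq0 -leqNgt.
exists (col j (cokermx W)) => //.
have : W *m col j (cokermx W) = 0 by rewrite colE mulmxA mulmx_coker mul0mx.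
rewrite !mul_col_mx => W0; have [MN0 L0] : col_mx (M *m col j (cokermx W))
    (N *m col j (cokermx W)) = 0 /\ L *m col j (cokermx W) = 0.
  by apply: eq_col_mx; rewrite W0 col_mx0.
have [M0 N0] : M *m col j (cokermx W) = 0 /\ N *m col j (cokermx W) = 0.
  by apply: eq_col_mx; rewrite MN0 col_mx0.
by split.
Qed.

End Spectral.

(** For a diagonalising unitary [U], the kernel of [pid_mx r *m U] is spanned by the eigenvectors of
    index at least [r], that of [copid_mx r *m U] by those of index below [r]. *)
Lemma pid_mx_entry (F : pzRingType) n r (w : 'cV[F]_n) i :
  (pid_mx r *m w) i 0 = w i 0 *+ (i < r)%N.
Proof.
rewrite mxE (bigD1 i)//= big1 ?addr0 => [|j ji].
  by rewrite mxE eqxx /= mulr_natl.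
by rewrite mxE (inj_eq val_inj) eq_sym (negPf ji) mul0r.
Qed.

Lemma copid_mx_entry (F : pzRingType) n r (w : 'cV[F]_n) i :
  (copid_mx r *m w) i 0 = w i 0 *+ (r <= i)%N.
Proof.
rewrite mulmxBl mul1mx mxE [X in _ + X]mxE pid_mx_entry.
by case: ltnP; rewrite ?subrr ?subr0.
Qed.

(** * Cauchy interlacing, and isometries with prescribed compression *)

Section Interlacing.
Context {R : realType}.
Local Notation C := R[i].

Lemma nth_eigvals_noninc n (A : 'M[C]_n) i j : (i <= j < n)%N ->
  nth 0 (eigvals A) j <= nth 0 (eigvals A) i.
Proof.
move=> /andP[ij jn].
have sA : sorted >=%R (eigvals A) by apply: sort_sorted; exact: ge_total.
by apply: (sorted_leq_nth ge_trans ge_refl 0 sA) => //; rewrite inE size_eigvals ?jn// (leq_ltn_trans ij).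
Qed.

(** The quadratic forms of both matrices are compared at a common vector. As [P *m A *m P] acts on
    the whole space, the kernel of [P] adds zeros to its spectrum, whence the sign condition. *)
Lemma eigvals_interlace (n d j : nat) (A P : 'M[C]_n) :
  A \is hermsymmx -> orthoprojmx P -> \rank P = d -> (j < d)%N ->
  0 <= nth 0 (eigvals A) j ->
  nth 0 (eigvals A) (n - d + j)%N <= nth 0 (eigvals (P *m A *m P)) j
    <= nth 0 (eigvals A) j.
Proof.
move=> hA [PP Pt] rP jd a0.
have dn : (d <= n)%N by rewrite -rP rank_leq_col.
set B := P *m A *m P.
have hB : B \is hermsymmx.
  rewrite hermsymmx_eq in hA.
  by rewrite hermsymmx_eq !trmxC_mul Pt (eqP hA) mulmxA.
have [U uU AE] := spectral_eigvals hA.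
have [W uW BE] := spectral_eigvals hB.
have BA (v : 'cV[C]_n) : (v^t* *m B *m v) 0 0 = ((P *m v)^t* *m A *m (P *m v)) 0 0.
  by rewrite trmxC_mul Pt /B !mulmxA.
have jn : (j < n)%N by exact: leq_trans dn.
(* For each bound, the spans of eigenvectors (and, for the lower one, the range
   of [P]) have codimensions adding up to [n - 1], hence a nonzero common [v]. *)
apply/andP; split.
  have [|v v0 [Pv Wv Uv]] :=
      @exists_ker _ n (1%:M - P) (pid_mx j *m W) (copid_mx (n - d + j).+1 *m U).
    have r1 : (\rank (1%:M - P)%R <= n - d)%N.
      rewrite -rP -mxrank_ker; apply: mxrankS; apply/sub_kermxP.
      by rewrite mulmxBl mul1mx PP subrr.
    have r2 := mxrankM_maxl (pid_mx j : 'M[C]_n) W.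
    have r3 := mxrankM_maxl (copid_mx (n - d + j).+1 : 'M[C]_n) U.
    rewrite rank_pid_mx ?(ltnW jn)// in r2.
    rewrite rank_copid_mx in r3; last by lia.
    apply: leq_ltn_trans (leq_add (leq_add r1 r2) r3) _; lia.
  have {}Pv : P *m v = v.
    by move/eqP: Pv; rewrite mulmxBl mul1mx subr_eq0 => /eqP.
  rewrite -lecR -(ler_pM2r (form_gt0 v0)).
  apply: (@le_trans _ _ ((v^t* *m B *m v) 0 0)).
    rewrite BA Pv [in leRHS]AE; apply: diag_form_ge => // i Uvi.
    apply: nth_eigvals_noninc; apply/andP; split; last by lia.
    rewrite -ltnS ltnNge; apply: contra Uvi => ij.
    have := copid_mx_entry (n - d + j).+1 (U *m v) i.
    by rewrite mulmxA Uv ij mulr1n mxE => <-.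
  rewrite [in leLHS]BE; apply: diag_form_le => // i Wvi.
  apply: nth_eigvals_noninc; rewrite ltn_ord andbT leqNgt; apply: contra Wvi => ij.
  have := pid_mx_entry j (W *m v) i.
  by rewrite mulmxA Wv ij mulr1n mxE => <-.
(* Two subspaces suffice here, hence the [0]. The condition on [A] bears on [P *m v], since the form
   of [B] at [v] is that of [A] at [P *m v]. *)
have [|v v0 [Wv Uv _]] := @exists_ker _ n (copid_mx j.+1 *m W) (pid_mx j *m U *m P) 0.
  have r2 := mxrankM_maxl (copid_mx j.+1 : 'M[C]_n) W.
  have r3 := mxrankM_maxl ((pid_mx j : 'M[C]_n) *m U) P.
  have r4 := mxrankM_maxl (pid_mx j : 'M[C]_n) U.
  rewrite rank_pid_mx ?(ltnW jn)// in r4.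
  rewrite rank_copid_mx// in r2.
  have r5 := leq_trans r3 r4.
  apply: leq_ltn_trans (leq_add (leq_add r2 r5) (leqnn _)) _.
  by rewrite mxrank0; lia.
rewrite -lecR -(ler_pM2r (form_gt0 v0)).
apply: (@le_trans _ _ ((v^t* *m B *m v) 0 0)).
  rewrite [in leRHS]BE; apply: diag_form_ge => // i Wvi.
  apply: nth_eigvals_noninc; rewrite jn andbT.
  rewrite -ltnS ltnNge; apply: contra Wvi => ij.
  have := copid_mx_entry j.+1 (W *m v) i.
  by rewrite mulmxA Wv ij mulr1n mxE => <-.
apply: (@le_trans _ _ ((nth 0 (eigvals A) j)%:C * ((P *m v)^t* *m (P *m v)) 0 0)).
  rewrite BA [in leLHS]AE; apply: diag_form_le => // i Uvi.
  apply: nth_eigvals_noninc; rewrite ltn_ord andbT leqNgt; apply: contra Uvi => ij.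
  have := pid_mx_entry j (U *m (P *m v)) i.
  by rewrite !mulmxA Uv ij mulr1n mxE => <-.
(* The eigenvalue being nonnegative, it remains to see that [P] does not lengthen [v]: the squared
   norms differ by that of [(1%:M - P) *m v]. *)
rewrite ler_wpM2l ?ler0c//.
have := form_ge0 ((1%:M - P) *m v).
have Q : ((1%:M - P) *m v)^t* *m ((1%:M - P) *m v) = v^t* *m v - (P *m v)^t* *m (P *m v).
  have Qt : (1%:M - P)^t* = 1%:M - P by rewrite linearB map_mxB/= trmx1 map_mx1 Pt.
  have QQ : (1%:M - P) *m (1%:M - P) = 1%:M - P.
    by rewrite mulmxBl mul1mx mulmxBr mulmx1 PP subrr subr0.
  rewrite !trmxC_mul Qt Pt -!mulmxA (mulmxA _ _ v) QQ (mulmxA P P) PP.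
  by rewrite mulmxBl mul1mx mulmxBr.
by rewrite Q mxE [X in _ + X]mxE subr_ge0.
Qed.

(** Cycling the factors of [P *m A *m P = V *m diag_mx _ *m V^t*] leaves the diagonal matrix; the
    powers of ['X] account for the [n - d] zeros. As [b] is non-increasing and nonnegative, the list
    is already sorted. *)
Lemma frame_projection (n d : nat) (A : 'M[C]_n) (V : 'M[C]_(n, d)) (b : nat -> R) :
  V^t* *m V = 1%:M -> V^t* *m A *m V = diag_mx (\row_j (b j)%:C) ->
  (forall j, (j.+1 < d)%N -> b j.+1 <= b j) ->
  (forall j, (j < d)%N -> 0 <= b j) ->
  let P := V *m V^t* in
  [/\ psdmx P, orthoprojmx P, \rank P = d &
      eigvals (P *m A *m P) = [seq b j | j <- iota 0 d] ++ nseq (n - d) 0].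
Proof.
move=> V1 VA bb b0 P.
have Pt : P^t* = P by rewrite trmxC_mul trmxCK.
have PV : P *m V = V by rewrite -mulmxA V1 mulmx1.
have rV : \rank V = d.
  apply/eqP; rewrite eqn_leq rank_leq_col/= -[X in (X <= _)%N](mxrank1 C d) -V1.
  exact: mxrankM_maxr.
have dn : (d <= n)%N by rewrite -rV rank_leq_row.
split.
- split; first by rewrite hermsymmx_eq Pt.
  move=> v; have := form_ge0 (V^t* *m v).
  by rewrite trmxC_mul trmxCK !mulmxA.
- by split => //; rewrite /P mulmxA -/P PV.
- apply/eqP; rewrite eqn_leq; apply/andP; split.
    by rewrite -[X in (_ <= X)%N]rV mxrankM_maxl.
  by rewrite -[X in (X <= _)%N]rV -{1}PV mxrankM_maxl.
apply: eigvals_sorted_char_poly.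
  apply/(sortedP 0) => i; rewrite size_cat size_map size_iota size_nseq subnKC// => id.
  rewrite !nth_cat size_map size_iota.
  have nthb k : (k < d)%N -> nth 0 [seq b j | j <- iota 0 d] k = b k.
    by move=> kd; rewrite (nth_map 0%N) ?size_iota// nth_iota.
  case: (ltnP i.+1 d) => id1; first by have id2 := ltnW id1; rewrite id2 !nthb//; exact: bb.
  rewrite !nth_nseq; case: (ltnP i d) => id2.
    by rewrite nthb//; case: ifP => _; exact: b0.
  by rewrite !if_same; exact: lexx.
pose B := diag_mx (\row_j (b j)%:C) *m V^t*.
have PAP : P *m A *m P = V *m B by rewrite /B -VA /P !mulmxA.
have Xd0 : 'X^d != 0 :> {poly C} by rewrite monic_neq0 ?monicXn.
apply: (mulIf Xd0); rewrite PAP char_poly_mulmxC /B -mulmxA V1 mulmx1 char_poly_diag.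
rewrite big_cat/= big_map big_nseq subr0 iter_mulr_1 mulrC -[in LHS](subnK dn).
rewrite exprD mulrA; congr (_ * _ * _).
have -> : iota 0 d = index_iota 0 d by rewrite /index_iota subn0.
rewrite big_mkord.
by apply: eq_bigr => j _; rewrite mxE.
Qed.

(** In an eigenbasis of [A] the problem is real and diagonal; the real isometry is then carried back
    by [U^t*]. *)
Lemma exists_frame (n d : nat) (A : 'M[C]_n) (b : nat -> R) :
  A \is hermsymmx -> (d <= n)%N ->
  (forall j, (j.+1 < d)%N -> b j.+1 <= b j) ->
  (forall j, (j < d)%N -> nth 0 (eigvals A) (n - d + j)%N <= b j <= nth 0 (eigvals A) j) ->
  exists2 V : 'M[C]_(n, d), V^t* *m V = 1%:M & V^t* *m A *m V = diag_mx (\row_j (b j)%:C).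
Proof.
move=> hA dn bb ab; have [U uU AE] := spectral_eigvals hA.
have [c nE] : exists c, n = (c + d)%N by exists (n - d)%N; rewrite subnK.
subst n; have [||W [W1 WA]] := @compresses_interlaces R c d (nth 0 (eigvals A)) b _ bb.
- by move=> i icd; apply: nth_eigvals_noninc; rewrite leqnSn.
- by move=> j jd; have := ab j jd; rewrite addnK.
pose Wc := map_mx (real_complex R) W.
have Wct : Wc^t* = map_mx (real_complex R) W^T.
  by apply/matrixP => i j; rewrite !mxE conjC_realc.
have UU : U *m U^t* = 1%:M by exact/unitarymxP.
exists (U^t* *m Wc); rewrite trmxC_mul trmxCK.
  by rewrite mulmxA -(mulmxA _ U) UU mulmx1 Wct -map_mxM W1 map_mx1.
rewrite {1}AE !mulmxA -(mulmxA _ U) UU mulmx1 -(mulmxA _ U) UU mulmx1 Wct.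
have -> : diag_mx (\row_i (nth 0 (eigvals A) i)%:C) =
    map_mx (real_complex R) (diag_mx (\row_(i < c + d) nth 0 (eigvals A) i)).
  by rewrite map_diag_mx; congr diag_mx; apply/rowP => i; rewrite !mxE.
rewrite -!map_mxM WA map_diag_mx; congr diag_mx; apply/rowP => i; rewrite !mxE//.
Qed.

End Interlacing.

(** * Measurable isometries *)

Section ComplexAlgebra.
Context {R : realType} (S : Type) (Cl : set (S -> R)) (FA : function_algebra Cl).
Local Notation C := R[i].

Definition in_complexification (F : S -> C) :=
  Cl (fun x => complex.Re (F x)) /\ Cl (fun x => complex.Im (F x)).

Lemma in_complexification_cst c : in_complexification (fun=> c).
Proof. by case: FA => Cc _ _ _; split; exact: Cc. Qed.

Lemma in_complexification_real (f : S -> R) : Cl f -> in_complexification (fun x => (f x)%:C).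
Proof. by case: FA => Cc _ _ _ Cf; split => //; exact: Cc. Qed.

Lemma in_complexificationD F G : in_complexification F -> in_complexification G ->
  in_complexification (fun x => F x + G x).
Proof.
case: FA => _ CD _ _ [F1 F2] [G1 G2]; split.
  by have := CD _ _ F1 G1; congr Cl; apply/funext => x /=; rewrite raddfD.
by have := CD _ _ F2 G2; congr Cl; apply/funext => x /=; rewrite raddfD.
Qed.

Lemma function_algebraN (f : S -> R) : Cl f -> Cl (fun x => - f x).
Proof.
case: FA => Cc _ CM _ Cf; have := CM _ _ (Cc (-1)) Cf.
by congr Cl; apply/funext => x /=; rewrite mulN1r.
Qed.

Lemma in_complexificationM F G : in_complexification F -> in_complexification G ->
  in_complexification (fun x => F x * G x).
Proof.
case: FA => _ CD CM _ [F1 F2] [G1 G2]; split.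
  have := CD _ _ (CM _ _ F1 G1) (function_algebraN (CM _ _ F2 G2)).
  by congr Cl; apply/funext => x /=; case: (F x) (G x) => [a b] [a' b'].
have := CD _ _ (CM _ _ F1 G2) (CM _ _ F2 G1).
by congr Cl; apply/funext => x /=; case: (F x) (G x) => [a b] [a' b'].
Qed.

Lemma in_complexification_conj F :
  in_complexification F -> in_complexification (fun x => (F x)^*).
Proof.
move=> [F1 F2]; split.
  by move: F1; congr Cl; apply/funext => x; case: (F x).
by have := function_algebraN F2; congr Cl; apply/funext => x; case: (F x).
Qed.

Lemma in_complexification_sum (I : Type) (r : seq I) (P : pred I) (F : I -> S -> C) :
  (forall i, in_complexification (F i)) ->
  in_complexification (fun x => \sum_(i <- r | P i) F i x).
Proof.
move=> CF; split.
  have := function_algebra_sum r P FA (fun i => (CF i).1).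
  by congr Cl; apply/funext => x; rewrite raddf_sum.
have := function_algebra_sum r P FA (fun i => (CF i).2).
by congr Cl; apply/funext => x; rewrite raddf_sum.
Qed.

Definition mx_in_complexification m n (F : S -> 'M[C]_(m, n)) :=
  forall i j, in_complexification (fun x => F x i j).

Lemma mx_in_complexificationM m n p (F : S -> 'M[C]_(m, n)) (G : S -> 'M[C]_(n, p)) :
  mx_in_complexification F -> mx_in_complexification G ->
  mx_in_complexification (fun x => F x *m G x).
Proof.
move=> CF CG i j; under [X in in_complexification X]eq_fun do rewrite mxE.
by apply: in_complexification_sum => k; exact: in_complexificationM.
Qed.

Lemma mx_in_complexificationB m n (F G : S -> 'M[C]_(m, n)) :
  mx_in_complexification F -> mx_in_complexification G ->
  mx_in_complexification (fun x => F x - G x).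
Proof.
move=> CF CG i j; under [X in in_complexification X]eq_fun do rewrite !mxE -mulN1r.
apply: in_complexificationD => //; apply: in_complexificationM => //.
exact: in_complexification_cst.
Qed.

Lemma mx_in_complexification_trC m n (F : S -> 'M[C]_(m, n)) :
  mx_in_complexification F -> mx_in_complexification (fun x => (F x)^t*).
Proof.
move=> CF i j; under [X in in_complexification X]eq_fun do rewrite !mxE.
exact: in_complexification_conj.
Qed.

Lemma mx_in_complexification_cst m n (M : 'M[C]_(m, n)) :
  mx_in_complexification (fun=> M).
Proof. by move=> i j; exact: in_complexification_cst. Qed.

Lemma mx_in_complexification_diag n (f : 'I_n -> S -> R) : (forall j, Cl (f j)) ->
  mx_in_complexification (fun x => diag_mx (\row_j (f j x)%:C)).
Proof.
move=> Cf i j; under [X in in_complexification X]eq_fun do rewrite !mxE.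
case: eqVneq => _; last exact: in_complexification_cst.
exact: in_complexification_real.
Qed.

End ComplexAlgebra.

(** * The equations for an isometry as one real equation *)

Section Defect.
Context {R : realType} (n d : nat).
Local Notation C := R[i].

(** An entrywise norm that avoids square roots, so as to stay inside any function algebra. *)
Definition mx_size (M : 'M[C]_d) : R :=
  \sum_i \sum_j (`|complex.Re (M i j)| + `|complex.Im (M i j)|).

Lemma mx_size_ge0 M : 0 <= mx_size M.
Proof. by do 2!apply: sumr_ge0 => ? _; exact: addr_ge0. Qed.

Lemma mx_size_eq0 M : (mx_size M == 0) = (M == 0).
Proof.
apply/eqP/eqP => [M0|->]; last first.
  by rewrite /mx_size big1// => i _; rewrite big1// => j _; rewrite mxE normr0 addr0.
apply/matrixP => i j; rewrite mxE; move: M0 => /eqP.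
rewrite psumr_eq0; last by move=> *; apply: sumr_ge0 => *; exact: addr_ge0.
move=> /allP/(_ i (mem_index_enum _))/=; rewrite psumr_eq0; last by move=> *; exact: addr_ge0.
move=> /allP/(_ j (mem_index_enum _))/=; rewrite paddr_eq0// !normr_eq0.
by move=> /andP[Re0 Im0]; apply/eqP; rewrite eq_complex Re0 Im0.
Qed.

Lemma mx_size_in (S : Type) (Cl : set (S -> R)) (F : S -> 'M[C]_d) :
  function_algebra Cl -> mx_in_complexification Cl F -> Cl (fun x => mx_size (F x)).
Proof.
move=> FA CF; do 2!apply: (function_algebra_sum _ _ FA) => ?.
by case: (FA) => _ CD _ CN; apply: CD; apply: CN; [exact: (CF _ _).1|exact: (CF _ _).2].
Qed.

(** The selection handles a single real equation, so both matrix equations are merged into one sum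
    of nonnegative terms. *)
Definition defect (A : 'M[C]_n) (b : 'I_d -> R) (V : 'M[C]_(n, d)) : R :=
  mx_size (V^t* *m V - 1%:M) + mx_size (V^t* *m A *m V - diag_mx (\row_j (b j)%:C)).

Lemma defect_eq0 A b V : (defect A b V == 0) =
  (V^t* *m V == 1%:M) && (V^t* *m A *m V == diag_mx (\row_j (b j)%:C)).
Proof. by rewrite paddr_eq0 ?mx_size_ge0// !mx_size_eq0 !subr_eq0. Qed.

Lemma defect_in (S : Type) (Cl : set (S -> R)) (A : S -> 'M[C]_n) (b : 'I_d -> S -> R)
    (V : S -> 'M[C]_(n, d)) : function_algebra Cl ->
  mx_in_complexification Cl A -> (forall j, Cl (b j)) -> mx_in_complexification Cl V ->
  Cl (fun x => defect (A x) (b ^~ x) (V x)).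
Proof.
move=> FA CA Cb CV; case: (FA) => _ CD _ _; apply: CD.
  apply: mx_size_in => //; apply: mx_in_complexificationB => //.
    by apply: mx_in_complexificationM => //; exact: mx_in_complexification_trC.
  exact: mx_in_complexification_cst.
apply: mx_size_in => //; apply: mx_in_complexificationB => //.
  apply: mx_in_complexificationM => //; apply: mx_in_complexificationM => //.
  exact: mx_in_complexification_trC.
exact: mx_in_complexification_diag.
Qed.

(** Real parts come first, then imaginary parts; isometries thus become points of a real cube. *)
Definition mx_of_coords (v : 'rV[R]_(n * d + n * d)) : 'M[C]_(n, d) :=
  \matrix_(i, j) (v 0 (lshift _ (mxvec_index i j)) +i* v 0 (rshift _ (mxvec_index i j))).

Lemma mx_of_coords_cube (V : 'M[C]_(n, d)) : V^t* *m V = 1%:M ->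
  exists2 v, cube v & mx_of_coords v = V.
Proof.
move=> V1; exists (row_mx (mxvec (map_mx (@complex.Re R) V)) (mxvec (map_mx (@complex.Im R) V))).
  have V_le1 i j : complex.Re (V i j) ^+ 2 + complex.Im (V i j) ^+ 2 <= 1.
    have /matrixP/(_ j j) := V1; rewrite !mxE eqxx (bigD1 i)//= !mxE mulrC => Vj.
    rewrite -lecR add_Re2_Im2 -[leRHS]Vj normCK lerDl; apply: sumr_ge0 => k _.
    by rewrite !mxE mulrC mul_conjC_ge0.
  have sqr_le1 (x y : R) : x ^+ 2 + y ^+ 2 <= 1 -> `|x| <= 1.
    move=> xy; rewrite -[leRHS]normr1 -ler_sqr ?nnegrE// real_normK ?num_real// normr1 expr1n.
    by apply: le_trans xy; rewrite lerDl sqr_ge0.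
  move=> k; rewrite -[k]splitK; case: (fintype.split k) => k'; case/mxvec_indexP: k' => i j /=;
    rewrite ?row_mxEl ?row_mxEr mxvecE mxE.
    exact: sqr_le1 (V_le1 i j).
  by apply: (@sqr_le1 _ (complex.Re (V i j))); rewrite addrC V_le1.
apply/matrixP => i j; rewrite mxE row_mxEl row_mxEr !mxvecE !mxE.
by case: (V i j).
Qed.

Lemma measurable_frame d0 (T : measurableType d0) (X : set T) (mX : measurable X)
    (G : T -> 'M[C]_n) (b : 'I_d -> T -> R) :
  measurable_mxfun X G -> (forall j, measurable_fun X (b j)) ->
  (forall x, X x -> exists2 V : 'M[C]_(n, d), V^t* *m V = 1%:M &
     V^t* *m G x *m V = diag_mx (\row_j (b j x)%:C)) ->
  exists2 V : T -> 'M[C]_(n, d),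
    mx_in_complexification [set f : T -> R | measurable_fun X f] V &
    forall x, X x -> (V x)^t* *m V x = 1%:M /\
      (V x)^t* *m G x *m V x = diag_mx (\row_j (b j x)%:C).
Proof.
move=> mG mb exV; pose N := (n * d + n * d)%N.
pose f x v := defect (G x) (b ^~ x) (mx_of_coords v).
have FM := function_algebra_measurable R X.
have FC := @function_algebra_continuous R 'rV[R]_N.
have coordsC : mx_in_complexification [set f : 'rV[R]_N -> R | continuous f] mx_of_coords.
  by move=> i j; split => /= v; under eq_fun do rewrite mxE /=; exact: coord_continuous.
have cf : caratheodory X f.
  split => [v|x Xx].
    apply: (defect_in (Cl := [set f : T -> R | measurable_fun X f])) => //.
    exact: mx_in_complexification_cst.
  apply: (defect_in (Cl := [set f : 'rV[R]_N -> R | continuous f])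
    (A := fun=> G x) (b := fun j _ => b j x)) => //.
    exact: mx_in_complexification_cst.
  by move=> j /=; have [+ _ _ _] := FC; apply.
have [q qK Kq] := dense_cube R N.
have coord_cont (i : 'I_N) : continuous (fun v : 'rV[R]_N => v 0 i).
  exact: coord_continuous.
(* Selecting along all of [enum 'I_N] fixes every coordinate of a zero, so the selected values
   themselves form that zero. *)
have [|p mp pP] := select_coordinates mX (@compact_cube R N) qK Kq (enum 'I_N) cf coord_cont.
  move=> x /exV[V V1 VG]; have [v Kv vV] := mx_of_coords_cube V1.
  by exists v => //; apply/eqP; rewrite defect_eq0 vV V1 VG !eqxx.
exists (fun x => mx_of_coords (\row_i p i x)).
  by move=> i j; split => /=; under eq_fun do rewrite !mxE /=; apply: mp; rewrite mem_enum.
move=> x /pP[v _ [/eqP]]; rewrite defect_eq0 => /andP[/eqP V1 /eqP VG] vp.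
suff -> : \row_i p i x = v by [].
by apply/rowP => i; rewrite mxE vp// mem_enum.
Qed.

End Defect.

(** * Measurability of the interlacing set, and the equivalence *)

Lemma nth_map_iota1 (T : Type) (x0 : T) (f : nat -> T) m i : (i < m)%N ->
  nth x0 [seq f j | j <- iota 1 m] i = f i.+1.
Proof. by move=> im; rewrite (nth_map 0%N) ?size_iota// nth_iota. Qed.

Lemma measurable_interlacing_set d0 (T : measurableType d0) (R : realType) (X : set T)
    (mX : measurable X) (n d : nat) (l b : nat -> T -> R) :
  (d <= n)%N ->
  (forall j, (1 <= j <= n)%N -> measurable_fun X (l j)) ->
  (forall j, (1 <= j <= d)%N -> measurable_fun X (b j)) ->
  measurable (X `&` [set x | forall j, (1 <= j <= d)%N ->
    l (n - d + j)%N x <= b j x <= l j x]).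
Proof.
(* The value [setT] for other [j] turns the condition into an intersection over all of [nat]. *)
move=> dn ml mb; pose F j := if (1 <= j <= d)%N
  then (X `&` [set x | l (n - d + j)%N x <= b j x]) `&` (X `&` [set x | b j x <= l j x])
  else setT.
rewrite (_ : _ `&` _ = X `&` \bigcap_j F j).
  apply: measurableI => //; apply: bigcapT_measurable => j; rewrite /F.
  case: ifPn => // jd; have /andP[j1 jd'] := jd.
  by apply: measurableI; apply: measurable_fun_le => //;
    (exact: mb || (apply: ml; apply/andP; split; lia)).
apply/seteqP; split => x [Xx xP]; split => // j.
  by move=> _; rewrite /F; case: ifPn => // /xP /andP[].
by move=> jd; have := xP j I; rewrite /F jd => -[[_ /= ->] [_ /= ->]].
Qed.

Theorem theorem6p3 (R : realType) (k n d : nat)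
  (X : set (lebesgueRk R k)) (mX : measurable X) (XT : X `<=` torus R k)
  (G : lebesgueRk R k -> 'M[R[i]]_n)
  (G_psd : forall x, X x -> psdmx (G x))
  (G_bounded : [bounded G x | x in X])
  (mG : measurable_mxfun X G)
  (lambda : nat -> lebesgueRk R k -> R)
  (lambda_ge0 : forall j x, (1 <= j <= n)%N -> X x -> 0 <= lambda j x)
  (mlambda : forall j, (1 <= j <= n)%N -> measurable_fun X (lambda j))
  (lambda_noninc : forall i j x, (1 <= i <= j)%N -> (j <= n)%N -> X x ->
     lambda j x <= lambda i x)
  (lambdaE : forall x, X x ->
     eigvals (G x) = [seq lambda j x | j <- iota 1 n])
  (d_bounds : (1 <= d <= n - 1)%N)
  (beta : nat -> lebesgueRk R k -> R)
  (beta_ge0 : forall j x, (1 <= j <= d)%N -> X x -> 0 <= beta j x)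
  (mbeta : forall j, (1 <= j <= d)%N -> measurable_fun X (beta j))
  (beta_noninc : forall i j x, (1 <= i <= j)%N -> (j <= d)%N -> X x ->
     beta j x <= beta i x) :
  {ae lebesgue_measureRk R k, forall x, X x -> forall j, (1 <= j <= d)%N ->
     lambda (n - d + j)%N x <= beta j x <= lambda j x}
  <->
  exists P : lebesgueRk R k -> 'M[R[i]]_n,
    [/\ measurable_mxfun X P,
        forall x, X x -> psdmx (P x),
        forall x, X x -> orthoprojmx (P x) &
        {ae lebesgue_measureRk R k, forall x, X x ->
           \rank (P x) = d /\
           eigvals (P x *m G x *m P x) =
             [seq beta j x | j <- iota 1 d] ++ nseq (n - d) 0}].
Proof.
have /andP[d1 dn1] := d_bounds.
have dn : (d <= n)%N by lia.
have hG x : X x -> G x \is hermsymmx by move=> /G_psd[].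
(* Lists of eigenvalues are numbered from 0, [lambda] and [beta] from 1. *)
have nthG x i : X x -> (i < n)%N -> nth 0 (eigvals (G x)) i = lambda i.+1 x.
  by move=> Xx i_n; rewrite lambdaE// nth_map_iota1.
split=> [ae1|[P [mP P_psd P_proj ae2]]]; last first.
  apply: filterS ae2 => x xP Xx j /andP[j0 jd].
  case: j j0 jd => // j _ jd; have [rP eP] := xP Xx.
  have jn : (j < n)%N by lia.
  have := @eigvals_interlace R n d j (G x) (P x) (hG x Xx) (P_proj x Xx) rP jd.
  rewrite eP nth_cat size_map size_iota jd nth_map_iota1// !nthG//; last by lia.
  by rewrite addnS; apply; apply: lambda_ge0 => //; lia.
(* A frame is available where interlacing holds, so the selection is made on this measurable set;
   its complement in [X] is negligible by hypothesis. *)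
pose X0 := X `&` [set x | forall j, (1 <= j <= d)%N ->
  lambda (n - d + j)%N x <= beta j x <= lambda j x].
have mX0 : measurable X0 by exact: measurable_interlacing_set.
have X0X : X0 `<=` X by move=> x [].
have [|||V mV VP] := @measurable_frame R n d _ _ X0 mX0 G (fun j => beta j.+1).
- by move=> i j; have [m1 m2] := mG i j; split; exact: measurable_funS X0X _.
- by move=> j; apply: measurable_funS X0X _ => //; apply: mbeta; rewrite ltn_ord.
- move=> x [Xx xP]; apply: (@exists_frame R n d (G x) (fun j => beta j.+1 x)) => //.
  + exact: hG.
  + by move=> j jd; apply: beta_noninc => //; rewrite leqnSn.
  + move=> j jd; have ? : (n - d + j < n)%N by lia.
    by rewrite !nthG// ?(leq_trans jd)// -addnS; exact: xP.
(* Off [X0] the zero matrix is still a positive semidefinite projection; the rank and the spectrum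
   are claimed almost everywhere. *)
pose P x := if x \in X0 then V x *m (V x)^t* else 0.
have PP x : X x -> psdmx (P x) /\ orthoprojmx (P x) /\ (X0 x -> \rank (P x) = d /\
    eigvals (P x *m G x *m P x) = [seq beta j x | j <- iota 1 d] ++ nseq (n - d) 0).
  move=> Xx; rewrite /P; case: ifPn => [/set_mem X0x|/negP nX0]; last first.
    split; [split|split; [split|]].
    - by rewrite hermsymmx_eq trmx0 map_mx0.
    - by move=> v; rewrite mulmx0 mul0mx mxE.
    - by rewrite mulmx0.
    - by rewrite trmx0 map_mx0.
    - by move=> /mem_set/nX0.
  have [V1 VG] := VP x X0x.
  have [||psdV projV rV eV] := @frame_projection R n d (G x) (V x) (fun j => beta j.+1 x) V1 VG.
  - by move=> j jd; apply: beta_noninc => //; rewrite leqnSn.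
  - by move=> j jd; exact: beta_ge0.
  by do 3!split => //; rewrite eV (iotaDl 1 0) -map_comp.
exists P; split.
- move=> i j.
  have FM := function_algebra_measurable R X0.
  have [mRe mIm] := mx_in_complexificationM FM mV (mx_in_complexification_trC FM mV) i j.
  have mrestr (f : lebesgueRk R k -> R) : measurable_fun X0 f -> measurable_fun X (f \_ X0).
    by move=> mf; apply/measurable_restrict => //; rewrite (setIidr X0X).
  split; [move: (mrestr _ mRe)|move: (mrestr _ mIm)]; congr measurable_fun;
    by apply/funext => x; rewrite /P patchE; case: ifP => //; rewrite mxE.
- by move=> x /PP[].
- by move=> x /PP[_ []].
- apply: filterS ae1 => x xP Xx; have [_ [_]] := PP x Xx; apply.
  by split => // j jd; exact: xP.
Qed.
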